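(* Let $p$ be a real number. For all $x,y\in(0,1)$, $$\psi\left(H_p(x,y)\right)\leq H_p\left(\psi(x),\psi(y)\right)\quad\text{if } p\geq0,$$ and $$\psi\left(H_p(x,y)\right)\geq H_p\left(\psi(x),\psi(y)\right)\quad\text{if } p\leq-1.$$ Equality holds in each case if and only if $x=y$.
   Context: For $0<r<1$ let $\mathcal{K}(r)=\int_0^{\pi/2}\frac{dt}{\sqrt{1-r^2\sin^2t}}$ and $\mathcal{E}(r)=\int_0^{\pi/2}\sqrt{1-r^2\sin^2t}\,dt$ be the complete elliptic integrals of the first and second kind (argument is the modulus $r$). Put $r'=\sqrt{1-r^2}$, $\mathcal{K}'(r)=\mathcal{K}(r')$, $\mathcal{E}'(r)=\mathcal{E}(r')$ (the prime on $\mathcal{K},\mathcal{E}$ is not a derivative). The function $\psi:(0,1)\to(0,\infty)$ is defined by $$\psi(r)=\frac{2(\mathcal{E}(r)-(1-r)\mathcal{K}(r))}{\mathcal{E}'(r)-r\mathcal{K}'(r)}.$$ For $x,y>0$ the power mean is $H_p(x,y)=\left(\frac{x^p+y^p}{2}\right)^{1/p}$ if $p\neq0$, and $H_0(x,y)=\sqrt{xy}$. *)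

(* Defs.v *)
From Stdlib Require Import Reals.
From Coquelicot Require Import Coquelicot.
Open Scope R_scope.

(* The argument r is the modulus (not the parameter m = r^2); for 0 < r < 1 the
   integrands are continuous, so RInt is the genuine Riemann integral. *)
Definition ellK (r : R) : R :=
  RInt (fun t => 1 / sqrt (1 - r ^ 2 * sin t ^ 2)) 0 (PI / 2).

Definition ellE (r : R) : R :=
  RInt (fun t => sqrt (1 - r ^ 2 * sin t ^ 2)) 0 (PI / 2).

Definition comodulus (r : R) : R := sqrt (1 - r ^ 2).

(* The final c stands for "complementary" (the prime in K'(r) and E'(r), which
   is not a derivative). *)
Definition ellKc (r : R) : R := ellK (comodulus r).
Definition ellEc (r : R) : R := ellE (comodulus r).

(* Meaningful only for 0 < r < 1, where it is positive. *)
Definition psi (r : R) : R :=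
  2 * (ellE r - (1 - r) * ellK r) / (ellEc r - r * ellKc r).

(* Meaningful only for x, y > 0, where Rpower is the real power. *)
Definition power_mean (p x y : R) : R :=
  if Req_EM_T p 0 then sqrt (x * y)
  else Rpower ((Rpower x p + Rpower y p) / 2) (1 / p).

(* Main.v *)
Require Import Defs.
From Stdlib Require Import Reals Lra Psatz.
From Coquelicot Require Import Coquelicot.
Open Scope R_scope.

(** Write [psi = 2 N / D] with [N = E - (1 - r) K] and [D = E' - r K'].  Then
    [N' = E / (1 + r)], [D' = - (K' - E') / (1 + r)], and Legendre's relation (that
    [W = E K' + E' K - K K'] is constant) turns the elasticity [A = r psi' / psi] into
    [W r (1 - r) / ((1 + r) N D)].  Three monotonicity facts follow by comparing [N] and [D]
    with [E] and [K' - E']: [A] increases, [psi / r] increases, [A / (psi / r)] decreases.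
    The power mean [H_p] is the quasi-arithmetic mean of [phi_p = x^p / p] ([ln] for
    [p = 0]), and the slope of [phi_p o psi] against [phi_p] is [A (psi / r)^p].  It
    increases for [p >= 0] and decreases for [p <= -1], so [phi_p o psi] is strictly convex,
    resp. concave, as a function of [phi_p]. *)

(** * Integrals over [[0, PI / 2]] of functions of [1 - k^2 sin^2 t] *)

Lemma sin_sqr_bounds (t : R) : 0 <= sin t ^ 2 <= 1.
Proof.
  pose proof (sin2_cos2 t) as H. unfold Rsqr in H.
  pose proof (Rle_0_sqr (sin t)). pose proof (Rle_0_sqr (cos t)).
  unfold Rsqr in *. nra.
Qed.

Lemma modulus_pos (k t : R) : -1 < k < 1 -> 0 < 1 - k ^ 2 * sin t ^ 2.
Proof.
  intros Hk. pose proof (sin_sqr_bounds t).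
  assert (0 <= k ^ 2 < 1) by nra. nra.
Qed.

Lemma continuous_modulus (h : R -> R) (k t : R) :
  (forall s, 0 < s -> continuity_pt h s) -> -1 < k < 1 ->
  continuous (fun t => h (1 - k ^ 2 * sin t ^ 2)) t.
Proof.
  intros Hh Hk.
  apply (continuous_comp (fun t => 1 - k ^ 2 * sin t ^ 2) h).
  - apply (ex_derive_continuous (V := R_NormedModule)). auto_derive. trivial.
  - apply continuity_pt_filterlim, Hh, modulus_pos, Hk.
Qed.

(** Differentiation under the integral sign, stated so as to serve both [sqrt] and its reciprocal.
    On the open set [-1 < k < 1] the argument of [h] stays positive, so regularity on the positive
    reals is enough. *)
Lemma is_derive_RInt_modulus (h dh : R -> R) (k : R) :
  (forall s, 0 < s -> is_derive h s (dh s)) ->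
  (forall s, 0 < s -> continuity_pt dh s) ->
  -1 < k < 1 ->
  is_derive (fun k => RInt (fun t => h (1 - k ^ 2 * sin t ^ 2)) 0 (PI / 2)) k
    (RInt (fun t => dh (1 - k ^ 2 * sin t ^ 2) * (- 2 * k * sin t ^ 2)) 0 (PI / 2)).
Proof.
  intros Hd Hc Hk.
  assert (Hh : forall u t, -1 < u < 1 ->
    is_derive (fun u => h (1 - u ^ 2 * sin t ^ 2)) u
      (dh (1 - u ^ 2 * sin t ^ 2) * (- 2 * u * sin t ^ 2))).
  { intros u t Hu.
    replace (dh (1 - u ^ 2 * sin t ^ 2) * (- 2 * u * sin t ^ 2))
      with (scal (- 2 * u * sin t ^ 2) (dh (1 - u ^ 2 * sin t ^ 2)))
      by (unfold scal; simpl; unfold mult; simpl; ring).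
    apply (is_derive_comp h (fun u => 1 - u ^ 2 * sin t ^ 2)).
    - apply Hd, modulus_pos, Hu.
    - auto_derive; trivial; ring. }
  assert (Hloc : forall P : R -> Prop, (forall u, -1 < u < 1 -> P u) -> locally k P).
  { intros P HP. apply (locally_interval P k (-1) 1); simpl; try lra.
    intros u H1 H2. apply HP. simpl in *. lra. }
  evar_last.
  - apply (is_derive_RInt_param (fun k t => h (1 - k ^ 2 * sin t ^ 2))).
    + apply Hloc. intros u Hu t _. eexists. apply Hh, Hu.
    + intros t _.
      (* The explicit formula for [Derive] is available only for moduli near [k], so the replacement
         is local. *)
      apply continuity_2d_pt_ext_loc with
        (fun u v => dh (1 - u ^ 2 * sin v ^ 2) * (- 2 * u * sin v ^ 2)).
      * destruct (Hloc (fun u => -1 < u < 1) (fun u H => H)) as [d Hd'].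
        exists d. intros u v Hu _. symmetry. apply is_derive_unique, Hh.
        apply (Hd' u). exact Hu.
      * assert (Hs : continuity_2d_pt (fun _ v => sin v ^ 2) k t).
        { apply (continuity_1d_2d_pt_comp (fun z => sin z ^ 2) (fun _ v => v)).
          - apply continuity_pt_filterlim.
            apply (ex_derive_continuous (V := R_NormedModule)). auto_derive; trivial.
          - apply continuity_2d_pt_id2. }
        assert (Hu : continuity_2d_pt (fun u _ => u ^ 2) k t).
        { apply (continuity_1d_2d_pt_comp (fun z => z ^ 2) (fun u _ => u)).
          - apply continuity_pt_filterlim.
            apply (ex_derive_continuous (V := R_NormedModule)). auto_derive; trivial.
          - apply continuity_2d_pt_id1. }
        apply continuity_2d_pt_mult.
        -- apply (continuity_1d_2d_pt_comp dh (fun u v => 1 - u ^ 2 * sin v ^ 2)).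
           ++ apply Hc, modulus_pos, Hk.
           ++ apply continuity_2d_pt_minus; [apply continuity_2d_pt_const |].
              apply continuity_2d_pt_mult; assumption.
        -- apply continuity_2d_pt_mult; [| exact Hs].
           apply continuity_2d_pt_mult;
             [apply continuity_2d_pt_const | apply continuity_2d_pt_id1].
    + apply Hloc. intros u Hu.
      apply (ex_RInt_continuous (V := R_CompleteNormedModule)). intros t _.
      apply continuous_modulus; [| exact Hu].
      intros s Hs. apply continuity_pt_filterlim.
      apply (ex_derive_continuous (V := R_NormedModule)). eexists. apply Hd, Hs.
  - apply RInt_ext. intros t _. apply is_derive_unique, Hh, Hk.
Qed.

Lemma is_RInt_modulus (h : R -> R) (k : R) :
  (forall s, 0 < s -> continuity_pt h s) -> -1 < k < 1 ->
  is_RInt (fun t => h (1 - k ^ 2 * sin t ^ 2)) 0 (PI / 2)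
    (RInt (fun t => h (1 - k ^ 2 * sin t ^ 2)) 0 (PI / 2)).
Proof.
  intros Hh Hk. apply (RInt_correct (V := R_CompleteNormedModule)).
  apply (ex_RInt_continuous (V := R_CompleteNormedModule)).
  intros t _. apply continuous_modulus; assumption.
Qed.

Lemma continuity_pt_of_ex_derive (h : R -> R) (s : R) :
  ex_derive h s -> continuity_pt h s.
Proof.
  intros H. apply continuity_pt_filterlim.
  apply (ex_derive_continuous (V := R_NormedModule)), H.
Qed.

Lemma continuity_inv_sqrt (s : R) : 0 < s -> continuity_pt (fun s => 1 / sqrt s) s.
Proof.
  intros Hs. apply continuity_pt_of_ex_derive. pose proof (sqrt_lt_R0 s Hs).
  auto_derive. repeat split; lra.
Qed.

Lemma continuity_inv_sqrt3 (s : R) : 0 < s -> continuity_pt (fun s => 1 / (s * sqrt s)) s.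
Proof.
  intros Hs. apply continuity_pt_of_ex_derive. pose proof (sqrt_lt_R0 s Hs).
  auto_derive. split; [lra | split; [nra | trivial]].
Qed.

Lemma continuity_sqrt (s : R) : 0 < s -> continuity_pt sqrt s.
Proof. intros Hs. apply continuity_pt_sqrt. lra. Qed.

(** * Derivatives of the complete elliptic integrals *)

Lemma is_RInt_ellK (k : R) : -1 < k < 1 ->
  is_RInt (fun t => 1 / sqrt (1 - k ^ 2 * sin t ^ 2)) 0 (PI / 2) (ellK k).
Proof. exact (is_RInt_modulus (fun s => 1 / sqrt s) k continuity_inv_sqrt). Qed.

Lemma is_RInt_ellE (k : R) : -1 < k < 1 ->
  is_RInt (fun t => sqrt (1 - k ^ 2 * sin t ^ 2)) 0 (PI / 2) (ellE k).
Proof. exact (is_RInt_modulus sqrt k continuity_sqrt). Qed.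

(** With [q = sqrt (1 - k^2 sin^2 t)], the differentiated integrand [- k sin^2 t / q] is
    [(q - 1 / q) / k], because [k^2 sin^2 t = 1 - q^2]. *)
Lemma is_derive_ellE (k : R) : 0 < k < 1 ->
  is_derive ellE k ((ellE k - ellK k) / k).
Proof.
  intros Hk.
  assert (Hk' : -1 < k < 1) by lra.
  evar_last.
  - apply (is_derive_RInt_modulus sqrt (fun s => / (2 * sqrt s)) k).
    + intros s Hs. auto_derive; trivial. field.
      apply Rgt_not_eq, sqrt_lt_R0, Hs.
    + intros s Hs. apply continuity_pt_of_ex_derive.
      pose proof (sqrt_lt_R0 s Hs). auto_derive. repeat split; lra.
    + exact Hk'.
  - apply (is_RInt_unique (V := R_CompleteNormedModule)).
    apply (is_RInt_ext (V := R_NormedModule))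
      with (f := fun t => scal (/ k) (minus (sqrt (1 - k ^ 2 * sin t ^ 2))
                                            (1 / sqrt (1 - k ^ 2 * sin t ^ 2)))).
    + intros t _. unfold scal, minus, plus, opp; simpl; unfold mult; simpl.
      pose proof (modulus_pos k t Hk') as Hp.
      change (sin t * (sin t * 1)) with (sin t ^ 2).
      change (k * (k * 1)) with (k ^ 2).
      pose proof (sqrt_lt_R0 _ Hp) as Hq. pose proof (sqrt_sqrt _ (Rlt_le _ _ Hp)) as Hs.
      set (q := sqrt _) in *.
      apply (Rmult_eq_reg_r (k * q)); [| nra].
      replace (/ k * (q + - (1 / q)) * (k * q)) with (q * q - 1) by (field; lra).
      replace (/ (2 * q) * (- 2 * k * sin t ^ 2) * (k * q))
        with (- (k ^ 2 * sin t ^ 2)) by (field; lra).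
      lra.
    + replace ((ellE k - ellK k) / k) with (scal (/ k) (minus (ellE k) (ellK k)))
        by (unfold scal, minus, plus, opp; simpl; unfold mult; simpl; field; lra).
      apply (is_RInt_scal (V := R_NormedModule)), (is_RInt_minus (V := R_NormedModule)).
      * apply is_RInt_ellE, Hk'.
      * apply is_RInt_ellK, Hk'.
Qed.

(* Integrating the derivative of [sin t * cos t / sqrt (1 - k^2 sin^2 t)], which vanishes
   at both ends, reduces the power [-3/2] to [1/2]. *)
Lemma is_RInt_inv_sqrt3 (k : R) : 0 < k < 1 ->
  is_RInt (fun t => 1 / ((1 - k ^ 2 * sin t ^ 2) * sqrt (1 - k ^ 2 * sin t ^ 2)))
    0 (PI / 2) (ellE k / (1 - k ^ 2)).
Proof.
  intros Hk.
  assert (Hk' : -1 < k < 1) by lra.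
  (* At [s = 1 - k^2 sin^2 t], [g] is the derivative of [k^2 sin t cos t / sqrt s], so its integral
     vanishes. *)
  set (g := fun s => sqrt s - (1 - k ^ 2) * (1 / (s * sqrt s))).
  assert (Hg : forall s, 0 < s -> continuity_pt g s).
  { intros s Hs. apply continuity_pt_of_ex_derive. pose proof (sqrt_lt_R0 s Hs).
    unfold g. auto_derive. repeat split; try lra. nra. }
  assert (H0 : is_RInt (fun t => g (1 - k ^ 2 * sin t ^ 2)) 0 (PI / 2) 0).
  { evar_last.
    - apply (is_RInt_derive (V := R_CompleteNormedModule)
        (fun t => k ^ 2 * (sin t * cos t / sqrt (1 - k ^ 2 * sin t ^ 2)))).
      + intros t _. pose proof (modulus_pos k t Hk') as Hp.
        pose proof (sqrt_lt_R0 _ Hp) as Hq.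
        auto_derive.
        * change (sin t * (sin t * 1)) with (sin t ^ 2).
          change (k * (k * 1)) with (k ^ 2).
          repeat split; unfold Rminus in *; lra.
        * unfold g. change (sin t * (sin t * 1)) with (sin t ^ 2).
          change (k * (k * 1)) with (k ^ 2).
          fold (Rminus 1 (k ^ 2 * sin t ^ 2)).
          pose proof (sqrt_sqrt _ (Rlt_le _ _ Hp)) as Hs.
          assert (Hc : cos t * cos t = 1 - sin t * sin t).
          { pose proof (sin2_cos2 t) as HH. unfold Rsqr in HH. lra. }
          set (q := sqrt _) in *. rewrite <- Hs.
          assert (Hs' : k ^ 2 * (sin t * sin t) = 1 - q * q) by (rewrite Hs; ring).
          field_simplify_eq; [| lra].
          (* The terms are grouped so that [cos^2] and then [k^2 sin^2] can be eliminated in favour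
             of [q * q]; the factor [k^2 sin^2 + q * q] becomes 1. *)
          transitivity (2 * k ^ 2 * (cos t * cos t) * (k ^ 2 * (sin t * sin t) + q * q)
            - 2 * (k ^ 2 * (sin t * sin t)) * (q * q)); [ring |].
          rewrite Hc, Hs'.
          transitivity (2 * (k ^ 2 - k ^ 2 * (sin t * sin t)) - 2 * (1 - q * q) * (q * q));
            [ring |].
          rewrite Hs'. ring.
      + intros t _. apply continuous_modulus; assumption.
    - unfold minus, plus, opp; simpl. rewrite sin_0, cos_PI2. unfold Rdiv. ring. }
  apply (is_RInt_ext (V := R_NormedModule))
    with (f := fun t => scal (/ (1 - k ^ 2)) (minus (sqrt (1 - k ^ 2 * sin t ^ 2))
                                                    (g (1 - k ^ 2 * sin t ^ 2)))).
  - intros t _. unfold scal, minus, plus, opp; simpl; unfold mult; simpl. unfold g.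
    change (sin t * (sin t * 1)) with (sin t ^ 2).
    change (k * (k * 1)) with (k ^ 2).
    pose proof (modulus_pos k t Hk') as Hp.
    pose proof (sqrt_lt_R0 _ Hp) as Hq.
    set (s := 1 - k ^ 2 * sin t ^ 2) in *.
    field. repeat split; try lra. nra.
  - replace (ellE k / (1 - k ^ 2)) with (scal (/ (1 - k ^ 2)) (minus (ellE k) 0))
      by (unfold scal, minus, plus, opp; simpl; unfold mult; simpl; field; nra).
    apply (is_RInt_scal (V := R_NormedModule)), (is_RInt_minus (V := R_NormedModule)).
    + apply is_RInt_ellE, Hk'.
    + exact H0.
Qed.

(** With [q] the square root of [1 - k^2 sin^2 t], the differentiated integrand [k sin^2 t / q^3] is
    [(1 / q^3 - 1 / q) / k], and [is_RInt_inv_sqrt3] integrates the cubic term. *)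
Lemma is_derive_ellK (k : R) : 0 < k < 1 ->
  is_derive ellK k ((ellE k - (1 - k ^ 2) * ellK k) / (k * (1 - k ^ 2))).
Proof.
  intros Hk.
  assert (Hk' : -1 < k < 1) by lra.
  evar_last.
  - apply (is_derive_RInt_modulus (fun s => 1 / sqrt s)
             (fun s => - / 2 * (1 / (s * sqrt s))) k).
    + intros s Hs. pose proof (sqrt_lt_R0 s Hs) as Hq. auto_derive.
      * repeat split; lra.
      * replace (s * sqrt s) with (sqrt s * sqrt s * sqrt s)
          by (rewrite sqrt_sqrt; lra).
        field. lra.
    + intros s Hs. apply (continuity_pt_scal (fun s => 1 / (s * sqrt s))).
      apply continuity_inv_sqrt3, Hs.
    + exact Hk'.
  - apply (is_RInt_unique (V := R_CompleteNormedModule)).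
    apply (is_RInt_ext (V := R_NormedModule))
      with (f := fun t => scal (/ k)
        (minus (1 / ((1 - k ^ 2 * sin t ^ 2) * sqrt (1 - k ^ 2 * sin t ^ 2)))
               (1 / sqrt (1 - k ^ 2 * sin t ^ 2)))).
    + intros t _. unfold scal, minus, plus, opp; simpl; unfold mult; simpl.
      change (sin t * (sin t * 1)) with (sin t ^ 2).
      change (k * (k * 1)) with (k ^ 2).
      pose proof (modulus_pos k t Hk') as Hp.
      pose proof (sqrt_lt_R0 _ Hp) as Hq.
      set (q := sqrt _) in *.
      field. lra.
    + replace ((ellE k - (1 - k ^ 2) * ellK k) / (k * (1 - k ^ 2)))
        with (scal (/ k) (minus (ellE k / (1 - k ^ 2)) (ellK k)))
        by (unfold scal, minus, plus, opp; simpl; unfold mult; simpl; field; split; nra).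
      apply (is_RInt_scal (V := R_NormedModule)), (is_RInt_minus (V := R_NormedModule)).
      * apply is_RInt_inv_sqrt3, Hk.
      * apply is_RInt_ellK, Hk'.
Qed.

(** * Bounds by comparison of integrands *)

(** For [0 < t < PI / 2] the argument lies strictly between [1 - k^2] and [1], so the two integrands
    may touch at an end value, as they do in each bound below. *)
Lemma RInt_modulus_lt (h1 h2 : R -> R) (k : R) :
  (forall s, 0 < s -> continuity_pt h1 s) ->
  (forall s, 0 < s -> continuity_pt h2 s) ->
  0 < k < 1 -> (forall s, 1 - k ^ 2 < s < 1 -> h1 s < h2 s) ->
  RInt (fun t => h1 (1 - k ^ 2 * sin t ^ 2)) 0 (PI / 2) <
  RInt (fun t => h2 (1 - k ^ 2 * sin t ^ 2)) 0 (PI / 2).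
Proof.
  intros H1 H2 Hk H. pose proof PI_RGT_0.
  apply RInt_lt; [lra | | |].
  - intros t _. apply continuous_modulus; [assumption | lra].
  - intros t _. apply continuous_modulus; [assumption | lra].
  - intros t Ht. apply H.
    assert (0 < sin t) by (apply sin_gt_0; lra).
    assert (0 < cos t) by (apply cos_gt_0; lra).
    assert (0 < sin t ^ 2 < 1).
    { pose proof (sin2_cos2 t) as HH. unfold Rsqr in HH. nra. }
    assert (0 < k ^ 2) by nra. nra.
Qed.

Lemma RInt_const_modulus (c : R) : RInt (fun _ => c) 0 (PI / 2) = PI / 2 * c.
Proof. rewrite RInt_const. unfold scal; simpl; unfold mult; simpl. ring. Qed.

Lemma ellE_lt_PI2 (k : R) : 0 < k < 1 -> ellE k < PI / 2.
Proof.
  intros Hk. rewrite <- (Rmult_1_r (PI / 2)), <- RInt_const_modulus.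
  apply (RInt_modulus_lt sqrt (fun _ => 1)); trivial.
  - exact continuity_sqrt.
  - intros s _. apply continuity_pt_const. intros ? ?. reflexivity.
  - intros s Hs. rewrite <- sqrt_1. apply sqrt_lt_1; nra.
Qed.

Lemma ellK_gt_PI2 (k : R) : 0 < k < 1 -> PI / 2 < ellK k.
Proof.
  intros Hk. rewrite <- (Rmult_1_r (PI / 2)), <- RInt_const_modulus.
  apply (RInt_modulus_lt (fun _ => 1) (fun s => 1 / sqrt s)); trivial.
  - intros s _. apply continuity_pt_const. intros ? ?. reflexivity.
  - exact continuity_inv_sqrt.
  - intros s Hs. assert (0 < s) by nra. pose proof (sqrt_lt_R0 s H).
    assert (sqrt s < 1) by (rewrite <- sqrt_1; apply sqrt_lt_1; lra).
    apply (Rmult_lt_reg_r (sqrt s)); [lra |]. field_simplify; lra.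
Qed.

Lemma scal_ellK (c k : R) : -1 < k < 1 ->
  c * ellK k = RInt (fun t => c * (1 / sqrt (1 - k ^ 2 * sin t ^ 2))) 0 (PI / 2).
Proof.
  intros Hk. symmetry. apply (is_RInt_unique (V := R_CompleteNormedModule)).
  apply (is_RInt_scal (V := R_NormedModule)), is_RInt_ellK, Hk.
Qed.

Lemma ellE_gt (k : R) : 0 < k < 1 -> (1 - k ^ 2) * ellK k < ellE k.
Proof.
  intros Hk.
  rewrite scal_ellK by lra.
  apply (RInt_modulus_lt (fun s => (1 - k ^ 2) * (1 / sqrt s)) sqrt); trivial.
  - intros s Hs. apply (continuity_pt_scal (fun s => 1 / sqrt s)).
    apply continuity_inv_sqrt, Hs.
  - exact continuity_sqrt.
  - intros s Hs. assert (Hp : 0 < s) by nra. pose proof (sqrt_lt_R0 s Hp).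
    pose proof (sqrt_sqrt s (Rlt_le _ _ Hp)).
    apply (Rmult_lt_reg_r (sqrt s)); [lra |]. field_simplify; [| lra]. nra.
Qed.

(** The integrand increases to its end value 1 at [t = PI / 2]. At the complementary modulus this
    reads [r K' < PI / 2], which later bounds [psiD] from below. *)
Lemma ellK_lt (k : R) : 0 < k < 1 -> sqrt (1 - k ^ 2) * ellK k < PI / 2.
Proof.
  intros Hk. rewrite <- (Rmult_1_r (PI / 2)), <- RInt_const_modulus.
  rewrite scal_ellK by lra.
  apply (RInt_modulus_lt (fun s => sqrt (1 - k ^ 2) * (1 / sqrt s)) (fun _ => 1)); trivial.
  - intros s Hs. apply (continuity_pt_scal (fun s => 1 / sqrt s)).
    apply continuity_inv_sqrt, Hs.
  - intros s _. apply continuity_pt_const. intros ? ?. reflexivity.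
  - intros s Hs. assert (Hp : 0 < s) by nra. pose proof (sqrt_lt_R0 s Hp).
    assert (sqrt (1 - k ^ 2) < sqrt s) by (apply sqrt_lt_1; nra).
    apply (Rmult_lt_reg_r (sqrt s)); [lra |]. field_simplify; lra.
Qed.

(** * The complementary integrals *)

Lemma comodulus_sqr (r : R) : 0 < r < 1 -> comodulus r ^ 2 = 1 - r ^ 2.
Proof. intros Hr. unfold comodulus. rewrite pow2_sqrt; nra. Qed.

Lemma comodulus_bounds (r : R) : 0 < r < 1 -> 0 < comodulus r < 1.
Proof.
  intros Hr. pose proof (comodulus_sqr r Hr).
  assert (0 < comodulus r) by (apply sqrt_lt_R0; nra). nra.
Qed.

Lemma is_derive_comodulus (r : R) : 0 < r < 1 ->
  is_derive comodulus r (- r / comodulus r).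
Proof.
  intros Hr. assert (0 < 1 - r ^ 2) by nra.
  pose proof (sqrt_lt_R0 _ H) as Hq. unfold comodulus.
  auto_derive.
  - change (r * (r * 1)) with (r ^ 2). unfold Rminus in *. lra.
  - change (r * (r * 1)) with (r ^ 2). fold (Rminus 1 (r ^ 2)). field. lra.
Qed.

Lemma is_derive_ellKc (r : R) : 0 < r < 1 ->
  is_derive ellKc r (- (ellEc r - r ^ 2 * ellKc r) / (r * (1 - r ^ 2))).
Proof.
  intros Hr. pose proof (comodulus_bounds r Hr) as Hc.
  pose proof (comodulus_sqr r Hr) as Hs.
  evar_last.
  - apply (is_derive_comp ellK comodulus).
    + apply is_derive_ellK, Hc.
    + apply is_derive_comodulus, Hr.
  - unfold scal; simpl; unfold mult; simpl. fold (ellKc r) (ellEc r).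
    change (comodulus r * (comodulus r * 1)) with (comodulus r ^ 2).
    replace (1 - comodulus r ^ 2) with (r ^ 2) by lra.
    change (r * (r * 1)) with (r ^ 2). rewrite <- Hs. field. lra.
Qed.

Lemma is_derive_ellEc (r : R) : 0 < r < 1 ->
  is_derive ellEc r (r * (ellKc r - ellEc r) / (1 - r ^ 2)).
Proof.
  intros Hr. pose proof (comodulus_bounds r Hr) as Hc.
  pose proof (comodulus_sqr r Hr) as Hs.
  evar_last.
  - apply (is_derive_comp ellE comodulus).
    + apply is_derive_ellE, Hc.
    + apply is_derive_comodulus, Hr.
  - unfold scal; simpl; unfold mult; simpl. fold (ellKc r) (ellEc r).
    change (r * (r * 1)) with (r ^ 2). rewrite <- Hs. field. lra.
Qed.

(** * Monotonicity and sign from derivatives *)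

Lemma increasing_of_deriv_pos (f df : R -> R) (a b : R) :
  a < b -> (forall t, a <= t <= b -> is_derive f t (df t)) ->
  (forall t, a < t < b -> 0 < df t) -> f a < f b.
Proof.
  intros Hab Hf Hd.
  destruct (MVT_cor2 f df a b Hab) as [c [Hc1 Hc2]].
  - intros c Hc. apply is_derive_Reals, Hf, Hc.
  - specialize (Hd c Hc2). nra.
Qed.

Lemma decreasing_of_deriv_neg (f df : R -> R) (a b : R) :
  a < b -> (forall t, a <= t <= b -> is_derive f t (df t)) ->
  (forall t, a < t < b -> df t < 0) -> f b < f a.
Proof.
  intros Hab Hf Hd. apply Ropp_lt_cancel.
  apply (increasing_of_deriv_pos (fun t => - f t) (fun t => - df t)); trivial.
  - intros t Ht. apply (is_derive_opp (V := R_NormedModule) f), Hf, Ht.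
  - intros t Ht. specialize (Hd t Ht). lra.
Qed.

(* The lower bound by [- c * (1 - t)] replaces the limit [0] at the right end point. *)
Lemma pos_of_decreasing_to_0 (f df : R -> R) (c : R) :
  (forall t, 0 < t < 1 -> is_derive f t (df t)) ->
  (forall t, 0 < t < 1 -> df t < 0) ->
  (forall t, 0 < t < 1 -> - c * (1 - t) <= f t) ->
  forall r, 0 < r < 1 -> 0 < f r.
Proof.
  intros Hf Hd Hb.
  assert (Hdec : forall a b, 0 < a -> a < b -> b < 1 -> f b < f a).
  { intros a b Ha Hab Hb'. apply (decreasing_of_deriv_neg f df); trivial.
    - intros t Ht. apply Hf. lra.
    - intros t Ht. apply Hd. lra. }
  intros r Hr. destruct (Rlt_le_dec 0 (f r)) as [|Hneg]; trivial. exfalso.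
  set (s := (1 + r) / 2).
  assert (Hs : f s < 0).
  { apply Rlt_le_trans with (f r); trivial. apply Hdec; unfold s; lra. }
  (* At the point [1 - e] of [(s, 1)] the lower bound [- c * e] exceeds [f s], against monotonicity;
     the denominator [1 + Rabs c] covers every sign of [c]. *)
  set (e := Rmin ((1 - s) / 2) (- f s / (1 + Rabs c))).
  assert (Hc : 0 < 1 + Rabs c) by (pose proof (Rabs_pos c); lra).
  assert (He : 0 < e).
  { apply Rmin_pos; [unfold s; lra |]. apply Rdiv_lt_0_compat; lra. }
  assert (He1 : e <= (1 - s) / 2) by apply Rmin_l.
  assert (He2 : e * (1 + Rabs c) <= - f s).
  { apply Rle_trans with (- f s / (1 + Rabs c) * (1 + Rabs c)).
    - apply Rmult_le_compat_r; [lra | apply Rmin_r].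
    - apply Req_le. field. lra. }
  assert (Hse : s < 1 - e) by (unfold s in *; lra).
  assert (H1 : f (1 - e) < f s) by (apply Hdec; unfold s in *; lra).
  specialize (Hb (1 - e) ltac:(unfold s in *; lra)).
  assert (c <= Rabs c) by apply Rle_abs. nra.
Qed.

Ltac rewrite_Derive H :=
  match type of H with
  | is_derive ?f ?x ?l =>
      replace (Derive (fun y : R => f y) x) with l
        by (symmetry; apply is_derive_unique; exact H)
  end.

(** * Numerator and denominator of [psi] *)

Definition psiN (r : R) : R := ellE r - (1 - r) * ellK r.
Definition psiD (r : R) : R := ellEc r - r * ellKc r.

Lemma is_derive_psiN (r : R) : 0 < r < 1 -> is_derive psiN r (ellE r / (1 + r)).
Proof.
  intros Hr. unfold psiN. pose proof (is_derive_ellE r Hr) as HE.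
  pose proof (is_derive_ellK r Hr) as HK.
  auto_derive.
  - repeat split; eexists; eassumption.
  - rewrite_Derive HE. rewrite_Derive HK.
    field. repeat split; nra.
Qed.

Lemma is_derive_psiD (r : R) : 0 < r < 1 ->
  is_derive psiD r (- (ellKc r - ellEc r) / (1 + r)).
Proof.
  intros Hr. unfold psiD. pose proof (is_derive_ellEc r Hr) as HE.
  pose proof (is_derive_ellKc r Hr) as HK.
  auto_derive.
  - repeat split; eexists; eassumption.
  - rewrite_Derive HE. rewrite_Derive HK.
    field. repeat split; nra.
Qed.

Lemma ellE_pos (r : R) : 0 < r < 1 -> 0 < ellE r.
Proof.
  intros Hr. pose proof (ellE_gt r Hr). pose proof (ellK_gt_PI2 r Hr).
  pose proof PI_RGT_0. assert (0 < 1 - r ^ 2) by nra. nra.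
Qed.

Lemma ellE_lt_ellK (r : R) : 0 < r < 1 -> ellE r < ellK r.
Proof.
  intros Hr. pose proof (ellE_lt_PI2 r Hr). pose proof (ellK_gt_PI2 r Hr). lra.
Qed.

Lemma psiN_pos (r : R) : 0 < r < 1 -> 0 < psiN r.
Proof.
  intros Hr. unfold psiN. pose proof (ellE_gt r Hr). pose proof (ellK_gt_PI2 r Hr).
  pose proof PI_RGT_0. assert (1 - r <= 1 - r ^ 2) by nra. nra.
Qed.

Lemma ellEc_bounds (r : R) : 0 < r < 1 -> r ^ 2 * ellKc r < ellEc r < PI / 2.
Proof.
  intros Hr. pose proof (comodulus_bounds r Hr) as Hc.
  pose proof (ellE_gt _ Hc) as H. rewrite (comodulus_sqr r Hr) in H.
  replace (1 - (1 - r ^ 2)) with (r ^ 2) in H by ring.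
  split; [exact H | apply ellE_lt_PI2, Hc].
Qed.

Lemma ellKc_bounds (r : R) : 0 < r < 1 -> PI / 2 < ellKc r /\ r * ellKc r < PI / 2.
Proof.
  intros Hr. pose proof (comodulus_bounds r Hr) as Hc.
  split; [apply ellK_gt_PI2, Hc |].
  pose proof (ellK_lt _ Hc) as H. rewrite (comodulus_sqr r Hr) in H.
  replace (1 - (1 - r ^ 2)) with (r ^ 2) in H by ring.
  rewrite sqrt_pow2 in H by lra. exact H.
Qed.

(** Both terms of [psiD] tend to [PI / 2] at 1, and [psiD] decreases because [E' < PI / 2 < K'].
    From [E' > r^2 K'] and [r K' < PI / 2] comes [psiD r > - (PI / 2) * (1 - r)]. *)
Lemma psiD_pos (r : R) : 0 < r < 1 -> 0 < psiD r.
Proof.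
  revert r. apply (pos_of_decreasing_to_0 _ _ (PI / 2) is_derive_psiD).
  - intros r Hr. pose proof (ellEc_bounds r Hr). pose proof (ellKc_bounds r Hr).
    apply (Rmult_lt_reg_r (1 + r)); [lra |]. field_simplify; lra.
  - intros r Hr. pose proof (ellEc_bounds r Hr). pose proof (ellKc_bounds r Hr).
    unfold psiD. nra.
Qed.

(** This is [psiD_lt] with the terms in [E'] and [K'] collected. Both sides tend to [3 PI / 2] at 1,
    and their difference decreases. *)
Lemma ellEc_lt (r : R) : 0 < r < 1 -> 3 * ellEc r < (1 + r + r ^ 2) * ellKc r.
Proof.
  intros Hr0.
  enough (0 < (1 + r + r ^ 2) * ellKc r - 3 * ellEc r) by lra.
  revert r Hr0.
  apply (pos_of_decreasing_to_0 (fun r => (1 + r + r ^ 2) * ellKc r - 3 * ellEc r)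
    (fun r => (r * (1 + r + r ^ 2) * ellKc r - (1 + 2 * r) * ellEc r) / (r * (1 + r)))
    (* From [K' > PI / 2 > E'] the difference exceeds [- (PI / 2) (1 - r) (2 + r)], and
       [2 + r < 3]. *)
    (3 * PI / 2)).
  - intros r Hr. pose proof (is_derive_ellEc r Hr) as HE.
    pose proof (is_derive_ellKc r Hr) as HK.
    auto_derive.
    + repeat split; eexists; eassumption.
    + rewrite_Derive HE. rewrite_Derive HK.
      field. repeat split; nra.
  - intros r Hr. pose proof (psiD_pos r Hr) as HD. unfold psiD in HD.
    pose proof (ellKc_bounds r Hr). pose proof PI_RGT_0.
    assert (0 < r * (1 + r)) by nra.
    apply (Rmult_lt_reg_r (r * (1 + r))); [lra |]. unfold Rdiv.
    rewrite Rmult_assoc, Rinv_l, Rmult_0_l, Rmult_1_r by lra.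
    (* By [E' > r K'] the numerator is below [- r^2 (1 - r) K']. *)
    assert (0 < ellKc r * (r * (1 - r))) by (apply Rmult_lt_0_compat; nra).
    nra.
  - intros r Hr. pose proof (ellEc_bounds r Hr). pose proof (ellKc_bounds r Hr).
    pose proof PI_RGT_0. nra.
Qed.

(** * Legendre's relation and the derivative of [psi] *)

(* Legendre's relation, without the value [PI / 2] of the constant. *)
Definition legendreW (r : R) : R :=
  ellE r * ellKc r + ellEc r * ellK r - ellK r * ellKc r.

Lemma is_derive_legendreW (r : R) : 0 < r < 1 -> is_derive legendreW r 0.
Proof.
  intros Hr. unfold legendreW.
  pose proof (is_derive_ellE r Hr) as HE. pose proof (is_derive_ellK r Hr) as HK.
  pose proof (is_derive_ellEc r Hr) as HE'. pose proof (is_derive_ellKc r Hr) as HK'.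
  auto_derive.
  - repeat split; eexists; eassumption.
  - rewrite_Derive HE. rewrite_Derive HK. rewrite_Derive HE'. rewrite_Derive HK'.
    field. repeat split; nra.
Qed.

Lemma legendreW_const (r s : R) : 0 < r < 1 -> 0 < s < 1 -> legendreW r = legendreW s.
Proof.
  intros Hr Hs.
  destruct (MVT_gen legendreW r s (fun _ => 0)) as [c [_ Hc]].
  - intros x Hx. apply is_derive_legendreW.
    unfold Rmin, Rmax in Hx; destruct (Rle_dec r s); lra.
  - intros x Hx. apply continuity_pt_of_ex_derive. eexists. apply is_derive_legendreW.
    unfold Rmin, Rmax in Hx; destruct (Rle_dec r s); lra.
  - lra.
Qed.

(** The right side is [(1 + r) (N' D - N D')], so Legendre's relation evaluates the numerator in the
    quotient rule for [N / D]. *)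
Lemma legendreW_eq (r : R) :
  (1 - r) * legendreW r = ellE r * psiD r + (ellKc r - ellEc r) * psiN r.
Proof. unfold legendreW, psiD, psiN. ring. Qed.

Lemma legendreW_pos (r : R) : 0 < r < 1 -> 0 < legendreW r.
Proof.
  intros Hr. apply (Rmult_lt_reg_l (1 - r)); [lra |].
  rewrite Rmult_0_r, legendreW_eq.
  pose proof (ellEc_bounds r Hr). pose proof (ellKc_bounds r Hr).
  apply Rplus_lt_0_compat; apply Rmult_lt_0_compat; try lra.
  - apply ellE_pos, Hr.
  - apply psiD_pos, Hr.
  - apply psiN_pos, Hr.
Qed.

Lemma psi_pos (r : R) : 0 < r < 1 -> 0 < psi r.
Proof.
  intros Hr. pose proof (psiN_pos r Hr). pose proof (psiD_pos r Hr).
  change (psi r) with (2 * psiN r / psiD r). apply Rdiv_lt_0_compat; lra.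
Qed.

Lemma is_derive_psi (r : R) : 0 < r < 1 ->
  is_derive psi r (2 * legendreW r * (1 - r) / ((1 + r) * psiD r ^ 2)).
Proof.
  intros Hr. change psi with (fun r => 2 * psiN r / psiD r).
  pose proof (is_derive_psiN r Hr) as HN. pose proof (is_derive_psiD r Hr) as HD.
  pose proof (psiD_pos r Hr) as Hp.
  replace (2 * legendreW r * (1 - r)) with (2 * ((1 - r) * legendreW r)) by ring.
  rewrite legendreW_eq.
  auto_derive.
  - repeat split; try (eexists; eassumption). lra.
  - rewrite_Derive HN. rewrite_Derive HD. field. lra.
Qed.

Definition elasticity (r : R) : R :=
  legendreW r * (r * (1 - r)) / ((1 + r) * psiN r * psiD r).

Lemma elasticity_eq (r : R) : 0 < r < 1 ->
  2 * legendreW r * (1 - r) / ((1 + r) * psiD r ^ 2) = elasticity r * psi r / r.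
Proof.
  intros Hr. pose proof (psiN_pos r Hr). pose proof (psiD_pos r Hr).
  change (psi r) with (2 * psiN r / psiD r). unfold elasticity. field. lra.
Qed.

(** * The three monotonicity facts *)

(* [psiD_lt] and [psiN_gt] say that [psiD * (1 + r)^(1/2) / (1 - r)^(3/2)] and
   [psiN * (1 - r^2)^(1/2) / r] decrease; the elasticity is [W] over their product. *)
Lemma psiD_lt (r : R) : 0 < r < 1 -> (2 + r) * psiD r < (1 - r) * (ellKc r - ellEc r).
Proof. intros Hr. pose proof (ellEc_lt r Hr). unfold psiD. nra. Qed.

Lemma psiN_gt (r : R) : 0 < r < 1 -> r * (1 - r) * ellE r < psiN r.
Proof.
  intros Hr. pose proof (ellE_gt r Hr). pose proof (ellE_pos r Hr). unfold psiN.
  (* After multiplication by [1 + r], [ellE_gt] gives [(1 + r) N > r E]; the term [r^3 E] is the gap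
     down to [r (1 - r^2) E]. *)
  assert (0 < r ^ 3 * ellE r) by (apply Rmult_lt_0_compat; [apply pow_lt|]; lra).
  apply (Rmult_lt_reg_r (1 + r)); [lra |]. nra.
Qed.

Lemma psiN_lt (r : R) : 0 < r < 1 -> psiN r < r * ellE r.
Proof. intros Hr. pose proof (ellE_lt_ellK r Hr). unfold psiN. nra. Qed.

(** This is the sign of the derivative of [N^2 (1 + r) / (r^2 (1 - r))], needed in
    [elasticity_div_decreasing]. *)
Lemma psiN_lt_quadratic (r : R) : 0 < r < 1 ->
  (1 - r - r ^ 2) * psiN r < r * (1 - r) * ellE r.
Proof.
  intros Hr. pose proof (ellE_gt r Hr). pose proof (ellE_lt_ellK r Hr).
  pose proof (ellE_pos r Hr).
  enough (0 < (1 - 2 * r) * (ellK r - ellE r) + r ^ 3 * ellK r) by (unfold psiN; nra).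
  assert (H3 : 0 < r ^ 3 * ellK r) by (apply Rmult_lt_0_compat; [apply pow_lt|]; lra).
  assert (H2 : 0 < r ^ 2 * (1 - r) * ellK r) by (apply Rmult_lt_0_compat; nra).
  (* For [2 r > 1] the first term is negative, but [K - E < r^2 K] by [ellE_gt], and [r^2 (1 - r) K]
     remains. *)
  destruct (Rle_lt_dec (2 * r) 1); [nra |].
  assert (0 < (2 * r - 1) * (r ^ 2 * ellK r - (ellK r - ellE r)))
    by (apply Rmult_lt_0_compat; lra).
  nra.
Qed.

Lemma elasticity_pos (r : R) : 0 < r < 1 -> 0 < elasticity r.
Proof.
  intros Hr. pose proof (psiN_pos r Hr). pose proof (psiD_pos r Hr).
  pose proof (legendreW_pos r Hr). unfold elasticity.
  apply Rdiv_lt_0_compat; repeat apply Rmult_lt_0_compat; lra.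
Qed.

(** By [legendreW_eq] the claim is [r E D + r (K' - E') N > (1 + r) N D]. It is the sum of
    [r E D > N D] and [r (K' - E') N > r N D]; the latter uses [D < K' - E'], a consequence of
    [psiD_lt]. *)
Lemma elasticity_gt_1 (r : R) : 0 < r < 1 -> 1 < elasticity r.
Proof.
  intros Hr. pose proof (psiN_pos r Hr). pose proof (psiD_pos r Hr).
  pose proof (psiD_lt r Hr). pose proof (psiN_lt r Hr).
  pose proof (ellKc_bounds r Hr). pose proof (ellEc_bounds r Hr).
  unfold elasticity.
  replace (legendreW r * (r * (1 - r))) with (r * ((1 - r) * legendreW r)) by ring.
  rewrite legendreW_eq.
  assert (Hp : 0 < (1 + r) * psiN r * psiD r)
    by (repeat apply Rmult_lt_0_compat; lra).
  apply Rlt_div_r; [exact Hp |].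
  assert (psiD r < ellKc r - ellEc r) by nra.
  assert (0 < psiD r * (r * ellE r - psiN r)) by (apply Rmult_lt_0_compat; lra).
  assert (0 < r * psiN r * (ellKc r - ellEc r - psiD r))
    by (repeat apply Rmult_lt_0_compat; lra).
  nra.
Qed.

(** Since [W] is constant, it suffices that [G = W / A] decreases. *)
Lemma elasticity_increasing (a b : R) :
  0 < a -> a < b -> b < 1 -> elasticity a < elasticity b.
Proof.
  intros Ha Hab Hb.
  set (G := fun r => psiN r * psiD r * ((1 + r) / (r * (1 - r)))).
  assert (HG : forall r, 0 < r < 1 -> 0 < G r).
  { intros r Hr. pose proof (psiN_pos r Hr). pose proof (psiD_pos r Hr). unfold G.
    repeat apply Rmult_lt_0_compat; try lra. apply Rinv_0_lt_compat. nra. }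
  assert (Hel : forall r, 0 < r < 1 -> elasticity r = legendreW r / G r).
  { intros r Hr. pose proof (psiN_pos r Hr). pose proof (psiD_pos r Hr).
    unfold elasticity, G. field. lra. }
  assert (Hdec : G b < G a).
  { apply (decreasing_of_deriv_neg G (fun r =>
      (r * (1 - r) * ellE r * psiD r - r * (1 - r) * (ellKc r - ellEc r) * psiN r
        + (r ^ 2 + 2 * r - 1) * (psiN r * psiD r)) / (r * (1 - r)) ^ 2)); trivial.
    - intros r Hr0. assert (Hr : 0 < r < 1) by lra.
      pose proof (is_derive_psiN r Hr) as HN. pose proof (is_derive_psiD r Hr) as HD.
      unfold G. auto_derive.
      + repeat split; try (eexists; eassumption). nra.
      + rewrite_Derive HN. rewrite_Derive HD. field. lra.
    - intros r Hr0. assert (Hr : 0 < r < 1) by lra.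
      pose proof (psiN_pos r Hr). pose proof (psiD_pos r Hr).
      pose proof (psiD_lt r Hr). pose proof (psiN_gt r Hr).
      assert (Hp : 0 < r * (1 - r)) by nra.
      apply Rdiv_neg_pos; [| nra].
      (* Bounding the terms in [E] and [K' - E'] by multiples of [N D] leaves the coefficient
         [1 - r (2 + r) + (r^2 + 2 r - 1) = 0]. *)
      assert (0 < psiD r * (psiN r - r * (1 - r) * ellE r))
        by (apply Rmult_lt_0_compat; lra).
      assert (0 < r * psiN r * ((1 - r) * (ellKc r - ellEc r) - (2 + r) * psiD r))
        by (repeat apply Rmult_lt_0_compat; lra).
      nra. }
  rewrite !Hel by lra. rewrite (legendreW_const a b) by lra.
  apply Rmult_lt_compat_l; [apply legendreW_pos; lra |].
  apply Rinv_lt_contravar; [| exact Hdec].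
  apply Rmult_lt_0_compat; apply HG; lra.
Qed.

Lemma psi_div_increasing (a b : R) :
  0 < a -> a < b -> b < 1 -> psi a / a < psi b / b.
Proof.
  intros Ha Hab Hb.
  apply (increasing_of_deriv_pos (fun r => psi r / r)
    (fun r => (elasticity r - 1) * psi r / r ^ 2)); trivial.
  - intros r Hr0. assert (Hr : 0 < r < 1) by lra.
    pose proof (is_derive_psi r Hr) as H. rewrite (elasticity_eq r Hr) in H.
    auto_derive.
    + split; [eexists; eassumption | split; [lra | trivial]].
    + rewrite_Derive H. field. lra.
  - intros r Hr0. assert (Hr : 0 < r < 1) by lra.
    pose proof (elasticity_gt_1 r Hr). pose proof (psi_pos r Hr).
    apply Rdiv_lt_0_compat; [apply Rmult_lt_0_compat; lra | nra].
Qed.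

(** The factor [D] cancels: the quotient is [W / (2 M)] with [M] depending on [N] alone, and [M]
    increases by [psiN_lt_quadratic]. *)
Lemma elasticity_div_decreasing (a b : R) :
  0 < a -> a < b -> b < 1 ->
  elasticity b / (psi b / b) < elasticity a / (psi a / a).
Proof.
  intros Ha Hab Hb.
  set (M := fun r => psiN r ^ 2 * ((1 + r) / (r ^ 2 * (1 - r)))).
  assert (HM : forall r, 0 < r < 1 -> 0 < M r).
  { intros r Hr. pose proof (psiN_pos r Hr). unfold M.
    apply Rmult_lt_0_compat; [nra |]. apply Rdiv_lt_0_compat; [lra |].
    apply Rmult_lt_0_compat; nra. }
  assert (Hel : forall r, 0 < r < 1 -> elasticity r / (psi r / r) = legendreW r / 2 / M r).
  { intros r Hr. pose proof (psiN_pos r Hr). pose proof (psiD_pos r Hr).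
    change (psi r) with (2 * psiN r / psiD r). unfold elasticity, M. field. lra. }
  assert (Hinc : M a < M b).
  { apply (increasing_of_deriv_pos M (fun r =>
      2 * psiN r * (r * (1 - r) * ellE r - (1 - r - r ^ 2) * psiN r)
        / (r ^ 3 * (1 - r) ^ 2))); trivial.
    - intros r Hr0. assert (Hr : 0 < r < 1) by lra.
      pose proof (is_derive_psiN r Hr) as HN.
      unfold M. auto_derive.
      + repeat split; try (eexists; eassumption). apply Rgt_not_eq.
        repeat apply Rmult_lt_0_compat; lra.
      + rewrite_Derive HN. field. lra.
    - intros r Hr0. assert (Hr : 0 < r < 1) by lra.
      pose proof (psiN_pos r Hr). pose proof (psiN_lt_quadratic r Hr).
      apply Rdiv_lt_0_compat; repeat apply Rmult_lt_0_compat; lra. }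
  rewrite !Hel by lra. rewrite (legendreW_const a b) by lra.
  apply Rmult_lt_compat_l.
  - pose proof (legendreW_pos b ltac:(lra)). lra.
  - apply Rinv_lt_contravar; [| exact Hinc].
    apply Rmult_lt_0_compat; apply HM; lra.
Qed.

(** * Power means as quasi-arithmetic means *)

(* [phi p] is the increasing function whose quasi-arithmetic mean is the power mean. *)
Definition phi (p x : R) : R := if Req_EM_T p 0 then ln x else Rpower x p / p.

Lemma Rpower_pos (x p : R) : 0 < Rpower x p.
Proof. apply exp_pos. Qed.

(** The division by [p] in [phi] gives a single positive derivative for all [p], so [phi p]
    increases for negative [p] as well. *)
Lemma is_derive_phi (p x : R) : 0 < x -> is_derive (phi p) x (Rpower x p / x).
Proof.
  intros Hx. unfold phi. destruct (Req_EM_T p 0) as [-> | Hp].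
  - rewrite Rpower_O by exact Hx. unfold Rdiv. rewrite Rmult_1_l.
    apply is_derive_Reals, derivable_pt_lim_ln, Hx.
  - unfold Rpower. auto_derive; [exact Hx |]. field. split; [lra | exact Hp].
Qed.

Lemma phi_increasing (p x y : R) : 0 < x -> x < y -> phi p x < phi p y.
Proof.
  intros Hx Hxy. apply (increasing_of_deriv_pos _ (fun t => Rpower t p / t)); trivial.
  - intros t Ht. apply is_derive_phi. lra.
  - intros t Ht. apply Rdiv_lt_0_compat; [apply Rpower_pos | lra].
Qed.

Lemma phi_lt_inv (p x y : R) : 0 < y -> phi p x < phi p y -> x < y.
Proof.
  intros Hy H. destruct (Rtotal_order x y) as [| [-> | Hyx]]; trivial; [lra |].
  pose proof (phi_increasing p y x Hy Hyx). lra.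
Qed.

Lemma power_mean_pos (p x y : R) : 0 < x -> 0 < y -> 0 < power_mean p x y.
Proof.
  intros Hx Hy. unfold power_mean. destruct (Req_EM_T p 0).
  - apply sqrt_lt_R0. nra.
  - apply Rpower_pos.
Qed.

Lemma phi_power_mean (p x y : R) : 0 < x -> 0 < y ->
  phi p (power_mean p x y) = (phi p x + phi p y) / 2.
Proof.
  intros Hx Hy. pose proof (power_mean_pos p x y Hx Hy) as Hm. revert Hm.
  unfold phi, power_mean. destruct (Req_EM_T p 0) as [Hp | Hp]; intros Hm.
  - rewrite <- (ln_mult x y Hx Hy).
    rewrite <- (sqrt_sqrt (x * y)) at 2 by nra.
    rewrite ln_mult by exact Hm. field.
  - pose proof (Rpower_pos x p). pose proof (Rpower_pos y p).
    rewrite Rpower_mult. replace (1 / p * p) with 1 by (field; exact Hp).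
    rewrite Rpower_1 by lra. field. exact Hp.
Qed.

Lemma phi_inj (p x y : R) : 0 < x -> 0 < y -> phi p x = phi p y -> x = y.
Proof.
  intros Hx Hy H. destruct (Rtotal_order x y) as [Hl | [He | Hl]]; trivial.
  - pose proof (phi_increasing p x y Hx Hl). lra.
  - pose proof (phi_increasing p y x Hy Hl). lra.
Qed.

Lemma power_mean_diag (p x : R) : 0 < x -> power_mean p x x = x.
Proof.
  intros Hx. apply (phi_inj p); trivial.
  - apply power_mean_pos; exact Hx.
  - rewrite phi_power_mean by exact Hx. field.
Qed.

Lemma power_mean_lt_1 (p x y : R) : 0 < x < 1 -> 0 < y < 1 -> power_mean p x y < 1.
Proof.
  intros Hx Hy. apply (phi_lt_inv p); [lra |].
  rewrite phi_power_mean by lra.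
  pose proof (phi_increasing p x 1 (proj1 Hx) (proj2 Hx)).
  pose proof (phi_increasing p y 1 (proj1 Hy) (proj2 Hy)). lra.
Qed.

(** * Convexity of [phi p o psi] with respect to [phi p] *)

(* The derivative of [phi p o psi] with respect to [phi p]. *)
Definition slope (p r : R) : R := elasticity r * Rpower (psi r / r) p.

Lemma psi_div_pos (r : R) : 0 < r < 1 -> 0 < psi r / r.
Proof. intros Hr. apply Rdiv_lt_0_compat; [apply psi_pos |]; lra. Qed.

Lemma slope_increasing (p a b : R) :
  0 <= p -> 0 < a -> a < b -> b < 1 -> slope p a < slope p b.
Proof.
  intros Hp Ha Hab Hb. unfold slope.
  pose proof (elasticity_increasing a b Ha Hab Hb).
  pose proof (psi_div_increasing a b Ha Hab Hb).
  pose proof (elasticity_pos a ltac:(lra)).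
  pose proof (psi_div_pos a ltac:(lra)).
  assert (Rpower (psi a / a) p <= Rpower (psi b / b) p) by (apply Rle_Rpower_l; lra).
  pose proof (Rpower_pos (psi b / b) p). nra.
Qed.

(** With [q = psi / r], the slope is [(A / q) q^(p + 1)]. The first factor decreases, and the second
    does not increase exactly because [p + 1 <= 0] while [q] increases. *)
Lemma slope_decreasing (p a b : R) :
  p <= -1 -> 0 < a -> a < b -> b < 1 -> slope p b < slope p a.
Proof.
  intros Hp Ha Hab Hb. unfold slope.
  pose proof (elasticity_div_decreasing a b Ha Hab Hb) as H1.
  pose proof (psi_div_increasing a b Ha Hab Hb) as H2.
  pose proof (elasticity_pos b ltac:(lra)).
  pose proof (psi_div_pos a ltac:(lra)).
  assert (E : forall r, 0 < r < 1 -> elasticity r * Rpower (psi r / r) p =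
    elasticity r / (psi r / r) * / Rpower (psi r / r) (- p - 1)).
  { intros r Hr. pose proof (psi_div_pos r Hr) as Hq.
    rewrite <- Rpower_Ropp. unfold Rdiv at 2. rewrite Rmult_assoc. f_equal.
    rewrite <- (Rpower_1 (psi r / r) Hq) at 2. rewrite <- Rpower_Ropp.
    rewrite <- Rpower_plus. f_equal. ring. }
  rewrite !E by lra.
  assert (Rpower (psi a / a) (- p - 1) <= Rpower (psi b / b) (- p - 1))
    by (apply Rle_Rpower_l; lra).
  pose proof (Rpower_pos (psi a / a) (- p - 1)).
  assert (/ Rpower (psi b / b) (- p - 1) <= / Rpower (psi a / a) (- p - 1))
    by (apply Rinv_le_contravar; lra).
  assert (0 < / Rpower (psi a / a) (- p - 1)) by (apply Rinv_0_lt_compat; lra).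
  assert (0 < elasticity b / (psi b / b)) by (apply Rdiv_lt_0_compat; lra).
  nra.
Qed.

Lemma is_derive_tangent_gap (p c t : R) : 0 < t < 1 ->
  is_derive (fun t => phi p (psi t) - c * phi p t) t
    ((slope p t - c) * (Rpower t p / t)).
Proof.
  intros Ht. pose proof (psi_pos t Ht) as Hpsi.
  pose proof (is_derive_psi t Ht) as H1. rewrite (elasticity_eq t Ht) in H1.
  pose proof (is_derive_comp (phi p) psi t _ _ (is_derive_phi p _ Hpsi) H1) as H2.
  pose proof (is_derive_phi p t (proj1 Ht)) as H3.
  evar_last.
  - apply (is_derive_minus (V := R_NormedModule)); [exact H2 |].
    apply (is_derive_scal (phi p) t c _ H3).
  - unfold slope, minus, plus, opp, scal; simpl; unfold mult; simpl.
    (* Splitting [psi^p = (psi / t)^p t^p] exposes the common factor [t^p / t], the derivative of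
       [phi p]. *)
    replace (Rpower (psi t) p) with (Rpower (psi t / t) p * Rpower t p).
    + field. lra.
    + rewrite Rpower_mult_distr; [| apply psi_div_pos, Ht | lra].
      f_equal. field. lra.
Qed.

(* [s = 1] is the convex case and [s = -1] the concave one. *)
Lemma tangent_gap_pos (p s m t : R) :
  0 < m < 1 -> 0 < t < 1 -> t <> m ->
  (forall a b, 0 < a -> a < b -> b < 1 -> s * slope p a < s * slope p b) ->
  0 < s * (phi p (psi t) - phi p (psi m) - slope p m * (phi p t - phi p m)).
Proof.
  intros Hm Ht Htm Hs.
  (* The gap is [F t - F m], and the derivative of [F] has the sign of [t - m]. *)
  set (F := fun t => s * (phi p (psi t) - slope p m * phi p t)).
  enough (F m < F t) by (unfold F in *; lra).
  assert (HF : forall t, 0 < t < 1 ->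
    is_derive F t ((s * slope p t - s * slope p m) * (Rpower t p / t))).
  { intros u Hu. replace ((s * slope p u - s * slope p m) * (Rpower u p / u))
      with (s * ((slope p u - slope p m) * (Rpower u p / u))) by ring.
    apply (is_derive_scal (fun t => phi p (psi t) - slope p m * phi p t)).
    apply is_derive_tangent_gap, Hu. }
  assert (Hpos : forall u, 0 < u -> 0 < Rpower u p / u).
  { intros u Hu. apply Rdiv_lt_0_compat; [apply Rpower_pos | exact Hu]. }
  destruct (Rdichotomy _ _ Htm) as [Hl | Hl].
  - apply (decreasing_of_deriv_neg F _ t m Hl (fun u Hu => HF u ltac:(lra))).
    intros u Hu. specialize (Hs u m ltac:(lra) ltac:(lra) ltac:(lra)).
    specialize (Hpos u ltac:(lra)). nra.
  - apply (increasing_of_deriv_pos F _ m t Hl (fun u Hu => HF u ltac:(lra))).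
    intros u Hu. specialize (Hs m u ltac:(lra) ltac:(lra) ltac:(lra)).
    specialize (Hpos u ltac:(lra)). nra.
Qed.

(** In the variable [phi p] the mean [m] is the midpoint of [x] and [y], so adding the tangent
    inequalities at [m] cancels the linear terms. *)
Lemma phi_psi_midpoint (p s x y : R) :
  0 < x < 1 -> 0 < y < 1 -> x <> y ->
  (forall a b, 0 < a -> a < b -> b < 1 -> s * slope p a < s * slope p b) ->
  s * phi p (psi (power_mean p x y)) < s * phi p (power_mean p (psi x) (psi y)).
Proof.
  intros Hx Hy Hxy Hs.
  pose proof (phi_power_mean p x y (proj1 Hx) (proj1 Hy)) as Hphi.
  assert (Hm : 0 < power_mean p x y < 1).
  { split; [apply power_mean_pos; lra | apply power_mean_lt_1; assumption]. }
  set (m := power_mean p x y) in *.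
  rewrite phi_power_mean by (apply psi_pos; assumption).
  assert (Hne : phi p x <> phi p y).
  { intros E. apply Hxy, (phi_inj p); lra. }
  assert (Hxm : x <> m) by (intros E; rewrite <- E in Hphi; lra).
  assert (Hym : y <> m) by (intros E; rewrite <- E in Hphi; lra).
  pose proof (tangent_gap_pos p s m x Hm Hx Hxm Hs).
  pose proof (tangent_gap_pos p s m y Hm Hy Hym Hs).
  replace (phi p y - phi p m) with (- (phi p x - phi p m)) in * by lra.
  nra.
Qed.

Theorem theorem1p11 (p : R) :
  (0 <= p ->
     forall x y : R, 0 < x < 1 -> 0 < y < 1 ->
       psi (power_mean p x y) <= power_mean p (psi x) (psi y) /\
       (psi (power_mean p x y) = power_mean p (psi x) (psi y) <-> x = y)) /\
  (p <= -1 ->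
     forall x y : R, 0 < x < 1 -> 0 < y < 1 ->
       psi (power_mean p x y) >= power_mean p (psi x) (psi y) /\
       (psi (power_mean p x y) = power_mean p (psi x) (psi y) <-> x = y)).
Proof.
  assert (Hdiag : forall x, 0 < x < 1 ->
    psi (power_mean p x x) = power_mean p (psi x) (psi x)).
  { intros x Hx. rewrite !power_mean_diag; [reflexivity | | lra].
    apply psi_pos, Hx. }
  split; intros Hp x y Hx Hy.
  - assert (Hlt : x <> y -> psi (power_mean p x y) < power_mean p (psi x) (psi y)).
    { intros Hxy. apply (phi_lt_inv p).
      - apply power_mean_pos; apply psi_pos; assumption.
      - pose proof (phi_psi_midpoint p 1 x y Hx Hy Hxy) as H.
        rewrite !Rmult_1_l in H. apply H. intros a b Ha Hab Hb.
        rewrite !Rmult_1_l. apply slope_increasing; assumption. }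
    destruct (Req_dec x y) as [<- | Hxy].
    + rewrite Hdiag by exact Hx. repeat split; lra.
    + specialize (Hlt Hxy). split; [lra |]. split; [lra | contradiction].
  - assert (Hlt : x <> y -> power_mean p (psi x) (psi y) < psi (power_mean p x y)).
    { intros Hxy. apply (phi_lt_inv p).
      - apply psi_pos. split; [apply power_mean_pos; lra | apply power_mean_lt_1; assumption].
      - pose proof (phi_psi_midpoint p (-1) x y Hx Hy Hxy) as H.
        enough (-1 * phi p (psi (power_mean p x y))
                < -1 * phi p (power_mean p (psi x) (psi y))) by lra.
        apply H. intros a b Ha Hab Hb.
        pose proof (slope_decreasing p a b Hp Ha Hab Hb). lra. }
    destruct (Req_dec x y) as [<- | Hxy].
    + rewrite Hdiag by exact Hx. repeat split; lra.
    + specialize (Hlt Hxy). split; [lra |]. split; [lra | contradiction].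
Qed.
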